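(* Let $q^N\neq1$ for all $N\in\mathbb Z\setminus\{0\}$. Then $\mathcal R_{\pm,\mp}=1\otimes1+\sum_{n>0}\mathcal R^{(n)}_{\pm,\mp}$ with $$\mathcal R^{(n)}_{\pm,\mp}=(-1)^n\sum_{m=1}^n\ \sum_{\substack{j_1+\dots+j_m=n\\ j_i\ge1}}C_\pm(j_1,\dots,j_m)\oint\!\cdots\!\oint\prod_{i=1}^m\frac{dz_i}{2\pi i z_i}\ S_{f_0}^{j_1-1}\big(f_\pm(z_1)\big)\cdots S_{f_0}^{j_m-1}\big(f_\pm(z_m)\big)\otimes S_{e_0}^{j_1-1}\big(e_\mp(z_1)\big)\cdots S_{e_0}^{j_m-1}\big(e_\mp(z_m)\big),$$ where $$C_+(j_1,\dots,j_m)=\frac{(q^{-1}-q)^m}{j_1(j_1+j_2)\cdots(j_1+\dots+j_m)}\prod_{i=1}^m\frac{1}{[j_i]_q!\,[j_i-1]_q!},\qquad C_-(j_1,\dots,j_m)=\frac{(q^{-1}-q)^m}{j_m(j_m+j_{m-1})\cdots(j_m+\dots+j_1)}\prod_{i=1}^m\frac{1}{[j_i]_q!\,[j_i-1]_q!}.$$ Equivalently, $\mathcal R^{(n)}_{+,-}=\sum_{m}\sum_{j_1+\dots+j_m=n}\frac{I^{(j_1)}_{+,-}\cdots I^{(j_m)}_{+,-}}{j_1(j_1+j_2)\cdots(j_1+\dots+j_m)}$ and $\mathcal R^{(n)}_{-,+}=\sum_{m}\sum_{j_1+\dots+j_m=n}\frac{I^{(j_1)}_{-,+}\cdots I^{(j_m)}_{-,+}}{j_m(j_m+j_{m-1})\cdots(j_m+\dots+j_1)}$,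 with $I^{(j)}_{\pm,\mp}$ as defined in the context.
   Context: Fix $q\in\mathbb C$ with $q^N\neq1$ for all nonzero integers $N$. $U=U_q(\widehat{\mathfrak{sl}}_2)$ is the algebra (Drinfeld ''new realization'') generated by a central invertible element $q^{c}$, an element $d$, $k^{\pm1}$, $e_n,f_n$ ($n\in\mathbb Z$), $a_n$ ($n\in\mathbb Z\setminus\{0\}$), with generating series $e(z)=\sum_{n\in\mathbb Z}e_nz^{-n}$, $f(z)=\sum_{n\in\mathbb Z}f_nz^{-n}$, $\psi^\pm(z)=k^{\pm1}\exp\big(\pm(q-q^{-1})\sum_{n>0}a_{\pm n}z^{\mp n}\big)$, subject to the standard Drinfeld relations, including $(z-q^2w)e(z)e(w)=(q^2z-w)e(w)e(z)$, $(z-q^{-2}w)f(z)f(w)=(q^{-2}z-w)f(w)f(z)$, $[e(z),f(w)]=\frac{1}{q-q^{-1}}\big(\delta(z/(q^cw))\psi^+(zq^{-c/2})-\delta(zq^c/w)\psi^-(wq^{-c/2})\big)$ with $\delta(z)=\sum_nz^n$, $ke_nk^{-1}=q^2e_n$, $kf_nk^{-1}=q^{-2}f_n$. Half-currents: $e_+(z)=\sum_{n\ge0}e_nz^{-n}$, $e_-(z)=-\sum_{n<0}e_nz^{-n}$, $f_+(z)=\sum_{n>0}f_nz^{-n}$, $f_-(z)=-\sum_{n\le0}f_nz^{-n}$. Screening operators: $S_{e_0}(x)=e_0x-kxk^{-1}e_0$, $S_{f_0}(x)=xf_0-f_0kxk^{-1}$, applied coefficientwise. $[n]_q=\frac{q^n-q^{-n}}{q-q^{-1}}$,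 $[n]_q!=[1]_q\cdots[n]_q$, $[0]_q!=1$; $(a)_{q^2}=\frac{q^{2a}-1}{q^2-1}$, $\exp_{q^2}(x)=\sum_{n\ge0}x^n/(n)_{q^2}!$. $\oint\frac{dz}{2\pi iz}X(z)$ denotes the constant term in $z$. $\mathcal R_{+,-}=\prod_{m=\infty}^{1}\exp_{q^2}\big((q^{-1}-q)f_m\otimes e_{-m}\big)$ (factors ordered with $m$ decreasing from left to right), $\mathcal R_{-,+}=\prod_{n=0}^{\infty}\exp_{q^2}\big((q^{-1}-q)f_{-n}\otimes e_n\big)$ ($n$ increasing from left to right), in a completed tensor product $U\hat\otimes U$; $\mathcal R^{(n)}_{\pm,\mp}$ denotes the component of $\mathcal R_{\pm,\mp}$ of degree $n$ in the generators $f_m$ of the first tensor factor. $I^{(n)}_{+,-}=\frac{(-1)^n(q^{-1}-q)}{[n]_q![n-1]_q!}\oint\frac{dz}{2\pi iz}S_{f_0}^{n-1}(f_+(z))\otimes S_{e_0}^{n-1}(e_-(z))$ and $I^{(n)}_{-,+}=\frac{(-1)^n(q^{-1}-q)}{[n]_q![n-1]_q!}\oint\frac{dz}{2\pi iz}S_{f_0}^{n-1}(f_-(z))\otimes S_{e_0}^{n-1}(e_+(z))$. *)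

(* Defs.v *)
From HB Require Import structures.
From mathcomp Require Import all_boot all_order all_algebra.
From mathcomp Require Export complex reals.

Set Implicit Arguments.
Unset Strict Implicit.
Unset Printing Implicit Defensive.

Import Order.TTheory GRing.Theory Num.Theory.
Local Open Scope ring_scope.

Section QNumbers.
Variable K : fieldType.
Variable q : K.

Definition qint (n : int) : K := (q ^ n - q ^ (- n)) / (q - q^-1).
Definition qfact (n : nat) : K := \prod_(1 <= i < n.+1) qint (Posz i).
Definition qpar (a : nat) : K := (q ^+ (2 * a) - 1) / (q ^+ 2 - 1).
Definition qparfact (n : nat) : K := \prod_(1 <= i < n.+1) qpar i.
End QNumbers.

Section RingHelpers.
Variable W : ringType.

Definition zpow (g gi : W) (z : int) : W :=
  match z with Posz n => g ^+ n | Negz n => gi ^+ n.+1 end.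

Definition commr (x y : W) : W := x * y - y * x.

Definition comp_sum (k r : nat) (X : nat -> W) : W :=
  \sum_(c : {ffun 'I_k -> 'I_r.+1} |
          [forall i, 0 < (c i : nat)]%N && ((\sum_(i < k) (c i : nat))%N == r))
     \prod_(i < k) X (c i : nat).
End RingHelpers.

Section Psi.
Variable K : fieldType.
Variable q : K.
Variable W : algType K.

(* coefficient of z^{-r} in psi^+(z) = k exp((q-q^-1) sum_{n>0} a_n z^{-n}) *)
Definition psi_plus (k : W) (a : int -> W) (r : int) : W :=
  match r with
  | Posz r' => k * \sum_(j < r'.+1)
        ((j`!)%:R^-1 : K) *: comp_sum j r' (fun s => (q - q^-1) *: a (Posz s))
  | Negz _ => 0
  end.

(* coefficient of z^{-r} in psi^-(z) = k^-1 exp(-(q-q^-1) sum_{n>0} a_{-n} z^{n}) *)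
Definition psi_minus (ki : W) (a : int -> W) (r : int) : W :=
  match r with
  | Posz 0 => ki
  | Posz _ => 0
  | Negz r0 => ki * \sum_(j < r0.+2)
        ((j`!)%:R^-1 : K) *: comp_sum j r0.+1 (fun s => (- (q - q^-1)) *: a (- Posz s))
  end.
End Psi.

(* ---------- a representation of the Drinfeld generators and relations of
   U_q(\hat{sl}_2) in an algebra W.  gc stands for q^{c/2}, gci for q^{-c/2}. *)
Record UqRep (K : fieldType) (q : K) (W : algType K) := {
  gc : W; gci : W; dd : W; kk : W; ki : W;
  ee : int -> W; ff : int -> W; aa : int -> W;
  gc_inv_l : gc * gci = 1; gc_inv_r : gci * gc = 1;
  k_inv_l : kk * ki = 1; k_inv_r : ki * kk = 1;
  gc_d : commr gc dd = 0; gc_k : commr gc kk = 0; gc_ki : commr gc ki = 0;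
  gc_e : forall n, commr gc (ee n) = 0;
  gc_f : forall n, commr gc (ff n) = 0;
  gc_a : forall n, commr gc (aa n) = 0;
  d_k : commr dd kk = 0;
  d_e : forall n, commr dd (ee n) = n%:~R *: ee n;
  d_f : forall n, commr dd (ff n) = n%:~R *: ff n;
  d_a : forall n, n != 0 -> commr dd (aa n) = n%:~R *: aa n;
  k_a : forall n, n != 0 -> commr kk (aa n) = 0;
  k_e : forall n, kk * ee n * ki = q ^+ 2 *: ee n;
  k_f : forall n, kk * ff n * ki = q ^- 2 *: ff n;
  a_a : forall n m, n != 0 -> m != 0 ->
    commr (aa n) (aa m) =
      if n + m == 0 then
        (qint q (2 * n) / n%:~R / (q - q^-1)) *:
          (zpow gc gci (2 * n) - zpow gc gci (- (2 * n)))
      else 0;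
  a_e : forall n m, n != 0 ->
    commr (aa n) (ee m) = (qint q (2 * n) / n%:~R) *: (gci ^+ `|n|%N * ee (n + m));
  a_f : forall n m, n != 0 ->
    commr (aa n) (ff m) = - (qint q (2 * n) / n%:~R) *: (gc ^+ `|n|%N * ff (n + m));
  (* (z - q^2 w) e(z) e(w) = (q^2 z - w) e(w) e(z), coefficientwise *)
  e_e : forall n m,
    ee (n + 1) * ee m - q ^+ 2 *: (ee n * ee (m + 1)) =
    q ^+ 2 *: (ee m * ee (n + 1)) - ee (m + 1) * ee n;
  (* (z - q^-2 w) f(z) f(w) = (q^-2 z - w) f(w) f(z), coefficientwise *)
  f_f : forall n m,
    ff (n + 1) * ff m - q ^- 2 *: (ff n * ff (m + 1)) =
    q ^- 2 *: (ff m * ff (n + 1)) - ff (m + 1) * ff n;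
  (* [e(z),f(w)] = (delta(z/(q^c w)) psi^+(z q^{-c/2}) - delta(z q^c/w) psi^-(w q^{-c/2}))/(q-q^-1) *)
  e_f : forall n m,
    commr (ee n) (ff m) =
      (q - q^-1)^-1 *: (zpow gc gci (n - m) * psi_plus q kk aa (n + m)
                        - zpow gc gci (m - n) * psi_minus q ki aa (n + m))
}.

Arguments gc {K q W}. Arguments gci {K q W}. Arguments dd {K q W}.
Arguments kk {K q W}. Arguments ki {K q W}. Arguments ee {K q W}.
Arguments ff {K q W}. Arguments aa {K q W}.

Section Tensor.
Variable K : fieldType.
Variable q : K.
Variable W : algType K.

Definition is_gen (rho : UqRep q W) (x : W) : Prop :=
  x = gc rho \/ x = gci rho \/ x = dd rho \/ x = kk rho \/ x = ki rho \/
  (exists n, x = ee rho n) \/ (exists n, x = ff rho n) \/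
  (exists n, n != 0 /\ x = aa rho n).

(* two representations with commuting images: equivalently an algebra map
   U (x) U -> W, x (x) 1 |-> rho1 x, 1 (x) y |-> rho2 y *)
Definition commuting_pair (rho1 rho2 : UqRep q W) : Prop :=
  forall x y, is_gen rho1 x -> is_gen rho2 y -> x * y = y * x.

Variables rho1 rho2 : UqRep q W.

Definition Sf (x : W) : W := x * ff rho1 0 - ff rho1 0 * (kk rho1 * x * ki rho1).
Definition Se (x : W) : W := ee rho2 0 * x - kk rho2 * x * ki rho2 * ee rho2 0.

(* coefficients of z^{-r} of the half currents *)
Definition fplus (r : int) : W := if 0 < r then ff rho1 r else 0.
Definition fminus (r : int) : W := if r <= 0 then - ff rho1 r else 0.
Definition eplus (r : int) : W := if 0 <= r then ee rho2 r else 0.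
Definition eminus (r : int) : W := if r < 0 then - ee rho2 r else 0.

(* Component of R_{+,-} of degree n in the f's and of total mode M in the
   first tensor factor:
   R_{+,-} = prod_{m = oo}^{1} exp_{q^2}((q^-1-q) f_m (x) e_{-m}) *)
Definition Rpm_comp (n M : nat) : W :=
  \sum_(kf : {ffun 'I_M -> 'I_n.+1} |
          ((\sum_(i < M) (kf i : nat))%N == n) &&
          ((\sum_(i < M) (i.+1 * kf i))%N == M))
    \prod_(i <- rev (enum 'I_M))
       (((q^-1 - q) ^+ kf i / qparfact q (kf i)) *:
          ((ff rho1 (Posz i.+1) * ee rho2 (- Posz i.+1)) ^+ kf i)).

(* Component of R_{-,+} = prod_{m = 0}^{oo} exp_{q^2}((q^-1-q) f_{-m} (x) e_m)
   of degree n in the f's and total mode -M in the first tensor factor. *)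
Definition Rmp_comp (n M : nat) : W :=
  \sum_(kf : {ffun 'I_M.+1 -> 'I_n.+1} |
          ((\sum_(i < M.+1) (kf i : nat))%N == n) &&
          ((\sum_(i < M.+1) (i * kf i))%N == M))
    \prod_(i <- enum 'I_M.+1)
       (((q^-1 - q) ^+ kf i / qparfact q (kf i)) *:
          ((ff rho1 (- Posz i) * ee rho2 (Posz i)) ^+ kf i)).

Definition qfact_prod (m : nat) (j : 'I_m -> nat) : K :=
  \prod_(i < m) (qfact q (j i) * qfact q (j i).-1)^-1.
Definition Cplus (m : nat) (j : 'I_m -> nat) : K :=
  (q^-1 - q) ^+ m / (\prod_(i < m) ((\sum_(l < m | (l <= i)%N) j l)%N)%:R)
  * qfact_prod j.
Definition Cminus (m : nat) (j : 'I_m -> nat) : K :=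
  (q^-1 - q) ^+ m / (\prod_(i < m) ((\sum_(l < m | (i <= l)%N) j l)%N)%:R)
  * qfact_prod j.

(* Component of total first-factor mode M (resp. -M) of the right-hand side;
   the iterated constant term pairs the coefficient of z_i^{-r} in the
   f-half-current with that of z_i^{r} in the e-half-current. *)
Definition Rpm_rhs (n M : nat) : W :=
  \sum_(1 <= m < n.+1)
   \sum_(j : {ffun 'I_m -> 'I_n.+1} |
          [forall i, 0 < (j i : nat)]%N && ((\sum_(i < m) (j i : nat))%N == n))
     (((-1) ^+ n * Cplus (fun i => (j i : nat))) *:
      \sum_(r : {ffun 'I_m -> 'I_M.+1} | (\sum_(i < m) (r i : nat))%N == M)
        ((\prod_(i < m) iter (j i).-1 Sf (fplus (Posz (r i))))
         * (\prod_(i < m) iter (j i).-1 Se (eminus (- Posz (r i)))))).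

Definition Rmp_rhs (n M : nat) : W :=
  \sum_(1 <= m < n.+1)
   \sum_(j : {ffun 'I_m -> 'I_n.+1} |
          [forall i, 0 < (j i : nat)]%N && ((\sum_(i < m) (j i : nat))%N == n))
     (((-1) ^+ n * Cminus (fun i => (j i : nat))) *:
      \sum_(r : {ffun 'I_m -> 'I_M.+1} | (\sum_(i < m) (r i : nat))%N == M)
        ((\prod_(i < m) iter (j i).-1 Sf (fminus (- Posz (r i))))
         * (\prod_(i < m) iter (j i).-1 Se (eplus (Posz (r i)))))).
End Tensor.

(* Main.v *)
Require Import Defs.
From HB Require Import structures.
From mathcomp Require Import all_boot all_order all_algebra.
From mathcomp Require Import complex reals ring zify.
Set Implicit Arguments. Unset Strict Implicit. Unset Printing Implicit Defensive.
Import GRing.Theory Num.Theory.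
Local Open Scope ring_scope.

(* Put p = q^2, x_m = f_m and y_m = e_{-m}. Both families satisfy the same
   quadratic relation, and R_{+,-} = ... E_2 E_1 with E_a = exp_p(u t x_a y_a),
   u = q^-1 - q, where t records the degree. The formula is equivalent to
   t dR/dt = R I with I = sum_n t^n I^(n).

   The product R_{>=a} of the factors of index >= a has a logarithmic derivative
   I_{>=a} = sum_n c_n t^n sum_{m>=a} S'^{n-1}(x_m) (x) S'^{n-1}(y_m), where
   S'(w) = x_a w - p^{-deg w} w x_a and c_n = q^{n(n-1)} u / ([n]![n-1]!): by
   descending induction on a, it suffices that
   E_a I_{>=a} = I_{>=a+1} E_a + t dE_a/dt. The quadratic relation yields
   S^j(x_{m+j}) = (-1)^j S'^j(x_m), with S(w) = w x_a - p^{-deg w} x_a w and S'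
   taken with x_{a+1}, so I_{>=a+1} can be rewritten through S and x_a. The claim
   then splits into one identity for each m > a, valid for arbitrary x_m and y_m
   commuting with y_a and x_a respectively, and a scalar identity for m = a.
   The former is the terminating form of Heine's q-analogue of Euler's
   transformation of 2phi1; both of its sides satisfy the same three-term
   recurrence.

   For R_{-,+}, the relation is reversed by m |-> -m, so the same argument applies
   in the converse algebra. *)

(* Writing three vectors through a common linear map [f] reduces an identity
   in a module to one scalar identity per coordinate, within reach of [ring]. *)
Lemma common_linear (K : fieldType) (V : lmodType K) (x y z : V) :
  exists f : K -> K -> K -> V,
    [/\ x = f 1 0 0, y = f 0 1 0, z = f 0 0 1 &
      [/\ forall a b c a' b' c', f a b c + f a' b' c' = f (a + a') (b + b') (c + c'),
          forall a b c, - f a b c = f (- a) (- b) (- c) &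
          forall k a b c, k *: f a b c = f (k * a) (k * b) (k * c)]].
Proof.
exists (fun a b c => a *: x + b *: y + c *: z); split.
- by rewrite !scale0r !addr0 scale1r.
- by rewrite !scale0r addr0 add0r scale1r.
- by rewrite !scale0r !add0r scale1r.
split=> *; first by rewrite !scalerDl addrACA [_ *: x + _ + _]addrACA.
- by rewrite !opprD !scaleNr.
by rewrite !scalerDr !scalerA.
Qed.

(** * The symmetry behind the Euler transformation *)

Section EulerSymmetry.
Variables (K : fieldType) (p s : K) (ga ep : nat -> K).
Hypotheses (p_neq0 : p != 0) (p_expn1 : forall n, (0 < n)%N -> p ^+ n != 1).
Hypothesis ep0 : ep 0%N = 0.
Hypothesis epS : forall k, ep k.+1 * (1 - p ^+ k) = s * ep k.
Hypothesis gaS : forall n,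
  ga n.+1 * ((p ^+ n.+2 - 1) * (p ^+ n.+1 - 1)) = s * p ^+ n.+1 * p ^+ n.+1 * ga n.
Variable V : lmodType K.

(** Expanding the product of two twisted commutators of the same length gives this chain: [D] and
    [T] stand for left and right multiplication by the product of the two twisting elements, [U] for
    the mixed terms. *)
Fixpoint qchain (D T U : V -> V) (w : V) (n : nat) : V :=
  if n is m.+1 then
    let v := qchain D T U w m in
    D v - p ^- n *: U v + (p ^- n * p ^- n) *: T v
  else w.

(** The index [k] is shifted by one: [ep k] will be the q-exponential coefficient of degree [k.-1],
    and [ep 0 = 0] makes the boundary terms vanish. *)
Definition euler_term (D T U : V -> V) (w : V) (n k : nat) : V :=
  (ga n * ep k) *: iter k.-1 D (qchain D T U w n).

Definition euler_sum (D T U : V -> V) (w : V) (N : nat) : V :=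
  \sum_(i < N.+1) euler_term D T U w i (N - i).

Section Recurrence.
Variables (D T U : {linear V -> V}) (w : V).
Hypotheses (DT : forall v, D (T v) = T (D v)) (DU : forall v, D (U v) = U (D v)).
Local Notation h := (euler_term D T U w).

Lemma euler_term0 n : h n 0 = 0.
Proof. by rewrite /euler_term ep0 mulr0 scale0r. Qed.

Lemma euler_termD n k : s *: D (h n k) = (1 - p ^+ k) *: h n k.+1.
Proof.
case: k => [|k]; first by rewrite euler_term0 linear0 scaler0 subrr scale0r.
rewrite /euler_term linearZ !scalerA /=; congr (_ *: _).
by rewrite mulrCA -epS; ring.
Qed.

Lemma iter_comm (F : {linear V -> V}) k v : (forall v, D (F v) = F (D v)) ->
  iter k D (F v) = F (iter k D v).
Proof. by move=> DF; elim: k => //= k ->. Qed.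

Lemma iter_linear k b c v1 v2 v3 :
  iter k D (v1 - b *: v2 + c *: v3) =
  iter k D v1 - b *: iter k D v2 + c *: iter k D v3.
Proof. by elim: k => //= k ->; rewrite linearD linearB !linearZ. Qed.

(** The last link of [qchain] can be solved for [T]; [gaS] turns the coefficient of the new link
    into [ga n.+1]. *)
Lemma euler_termT n k : s *: T (h n k) =
  ((p ^+ n.+2 - 1) * (p ^+ n.+1 - 1)) *: h n.+1 k
  - (s * p ^+ n.+1 * p ^+ n.+1) *: D (h n k) + (s * p ^+ n.+1) *: U (h n k).
Proof.
rewrite /euler_term /= iter_linear //.
rewrite !linearZ /= (iter_comm _ _ DT) (iter_comm _ _ DU) -iterSr /=.
set X := D _; set Y := U _; set Z := T _; rewrite !scalerA.
have pu : p ^+ n.+1 != 0 by rewrite expf_neq0.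
have [f [-> -> -> [fD fN fZ]]] := common_linear X Y Z.
rewrite !(fZ, fN, fD).
have -> : ga n.+1 * ep k * ((p ^+ n.+2 - 1) * (p ^+ n.+1 - 1)) =
  s * p ^+ n.+1 * p ^+ n.+1 * ga n * ep k by rewrite -gaS; ring.
by congr f; field.
Qed.

(** The weight p^(N+1) of [U] makes all [U] terms cancel, which leaves two neighbouring terms of
    total index N+2. *)
Lemma euler_term_rec N i : (i <= N)%N ->
  s *: D (h i (N.+1 - i)) + s *: T (h i (N.+1 - i))
    - (s * p ^+ N.+1) *: U (h i (N.+1 - i)) - (s * s) *: D (T (h i (N - i))) =
  ((1 - p ^+ (N.+1 - i)) * (1 - p ^+ (N + i).+2)) *: h i (N.+2 - i)
  + ((p ^+ i.+2 - 1) * (p ^+ i.+1 - 1) * p ^+ (N - i)) *: h i.+1 (N.+2 - i.+1).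
Proof.
move=> leiN; rewrite subSS !subSn ?(leqW leiN) //.
set k := (N - i)%N; have -> : N = (i + k)%N by rewrite subnKC.
move: (euler_termD i k) (euler_termD i k.+1) (euler_termD i.+1 k).
move: (euler_termT i k) (euler_termT i k.+1).
move: (h i k) (h i k.+1) (h i k.+2) (h i.+1 k) (h i.+1 k.+1).
move=> c b a b' a' sTc sTb sDc sDb sDb'.
have sDDc : s *: D (D c) = (1 - p ^+ k) *: D b.
  by have := congr1 D sDc; rewrite !linearZ.
have sUDc : s *: U (D c) = (1 - p ^+ k) *: U b.
  by have := congr1 U sDc; rewrite !linearZ.
have sC (x : K) (v : V) : s *: (x *: v) = x *: (s *: v) by rewrite !scalerA mulrC.
have -> : (s * s) *: D (T c) = s *: D (s *: T c) by rewrite linearZ scalerA.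
rewrite sTc (linearD D) (linearB D) ![D (_ *: _)]linearZ /= DU scalerDr scalerBr !(sC (_ * _)).
rewrite sDDc sUDc sDb' sTb.
have sDb2 (x : K) : (s * p ^+ i.+1 * x) *: D b = (p ^+ i.+1 * x) *: (s *: D b).
  by rewrite scalerA; congr (_ *: _); ring.
have -> : (s * p ^+ i.+1 * p ^+ i.+1) *: ((1 - p ^+ k) *: D b) =
  (p ^+ i.+1 * p ^+ i.+1 * (1 - p ^+ k)) *: (s *: D b).
  by rewrite !scalerA; congr (_ *: _); ring.
rewrite sDb2 sDb.
have [f [-> -> -> [fD fN fZ]]] := common_linear a a' (U b).
rewrite !(fZ, fN, fD) !(addnS, addSn, exprS, exprD).
by congr f; ring.
Qed.

(** Once [D] and [T] commute, the right-hand side treats them alike; this is the source of the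
    symmetry below. *)
Lemma euler_sum_rec N :
  ((p ^+ N.+2 - 1) * (p ^+ N.+1 - 1)) *: euler_sum D T U w N.+2 =
  s *: D (euler_sum D T U w N.+1) + s *: T (euler_sum D T U w N.+1)
  - (s * p ^+ N.+1) *: U (euler_sum D T U w N.+1)
  - (s * s) *: D (T (euler_sum D T U w N)).
Proof.
have drop_last M : euler_sum D T U w M.+1 = \sum_(i < M.+1) h i (M.+1 - i).
  by rewrite /euler_sum big_ord_recr /= subnn euler_term0 addr0.
rewrite (drop_last N) {2}/euler_sum !linear_sum -!big_split /=.
have eq_rec (i : 'I_N.+1) : true -> _ := fun _ => @euler_term_rec N i (ltn_ord i).
rewrite (eq_bigr _ eq_rec) big_split big_ord_recr /= subnn euler_term0 scaler0 addr0.

(* Both ranges are extended by a zero term: the factor 1 - p^0 occurs at i = N+1 in the first sum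
   and at i = 0 in the shifted second one. *)
have -> : \sum_(i < N.+1) ((1 - p ^+ (N.+1 - i)) * (1 - p ^+ (N + i).+2)) *:
    h i (N.+2 - i) =
  \sum_(i < N.+2) ((1 - p ^+ (N.+1 - i)) * (1 - p ^+ (N + i).+2)) *:
    h i (N.+2 - i).
  by rewrite [RHS]big_ord_recr /= subnn subrr mul0r scale0r addr0.
have -> : \sum_(i < N.+1) ((p ^+ i.+2 - 1) * (p ^+ i.+1 - 1) * p ^+ (N - i)) *:
    h i.+1 (N.+2 - i.+1) =
  \sum_(i < N.+2) ((p ^+ i.+1 - 1) * (p ^+ i - 1) * p ^+ (N.+1 - i)) *:
    h i (N.+2 - i).
  by rewrite [RHS]big_ord_recl subrr mulr0 mul0r scale0r add0r.
rewrite -big_split /=.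
(* The two coefficients of the same term add up to a constant independent of i. *)
apply: eq_bigr => i _; rewrite -scalerDl; congr (_ *: _).
case: i => i /=; rewrite ltnS => /subnKC; move: (N.+1 - i)%N => k Nk.
have -> : ((N + i).+2 = i + k + i.+1)%N by lia.
have -> : (N.+2 = i + k.+1)%N by lia.
have -> : (N.+1 = i + k)%N by lia.
by rewrite !(exprS, exprD); ring.
Qed.
End Recurrence.

(** Both sides obey [euler_sum_rec], whose leading coefficient is nonzero, and they agree for N = 0
    and N = 1, where no operator survives. *)
Lemma euler_sum_sym (D T U : {linear V -> V}) (w : V) N :
  (forall v, D (T v) = T (D v)) -> (forall v, D (U v) = U (D v)) ->
  (forall v, T (U v) = U (T v)) ->
  euler_sum D T U w N = euler_sum T D U w N.
Proof.
move=> DT DU TU.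
suff: euler_sum D T U w N = euler_sum T D U w N /\
      euler_sum D T U w N.+1 = euler_sum T D U w N.+1 by case.
elim: N => [|N [IH0 IH1]].
  by rewrite /euler_sum !big_ord_recl !big_ord0 !euler_term0.
split=> //; apply: (@scalerI _ _ ((p ^+ N.+2 - 1) * (p ^+ N.+1 - 1))).
  by rewrite mulf_neq0 // subr_eq0 p_expn1.
rewrite !euler_sum_rec // IH0 IH1 DT.
by rewrite [X in X - _ - _]addrC.
Qed.

End EulerSymmetry.

(** * Solving n R_n = sum_j R_{n-j} G_j by sums over compositions *)

Section Compositions.
Variables (K : fieldType) (V : algType K).
Hypothesis natr_neq0 : forall n, (n.+1%:R : K) != 0.

Lemma prod_eq0 (I : eqType) (r : seq I) (F : I -> V) i :
  i \in r -> F i = 0 -> \prod_(j <- r) F j = 0.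
Proof.
move=> + Fi; elim: r => // j r IH; rewrite inE big_cons => /predU1P[<-|/IH ->].
  by rewrite Fi mul0r.
by rewrite mulr0.
Qed.

Definition fsnoc (T : Type) m (f : {ffun 'I_m -> T}) (t : T) : {ffun 'I_m.+1 -> T} :=
  [ffun i => oapp f t (unlift ord_max i)].

Lemma fsnoc_max T m (f : {ffun 'I_m -> T}) t : fsnoc f t ord_max = t.
Proof. by rewrite ffunE unlift_none. Qed.

Lemma fsnoc_widen T m (f : {ffun 'I_m -> T}) t i :
  fsnoc f t (widen_ord (leqnSn m) i) = f i.
Proof.
have -> : widen_ord (leqnSn m) i = lift ord_max i.
  by apply/val_inj; rewrite /= /bump leqNgt ltn_ord.
by rewrite ffunE liftK.
Qed.

(** The bound [N <= B] ensures that the last entry fits into the index type, so that [inord] never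
    takes its default value. *)
Lemma sum_ffun_recr (B m N : nat) (F : {ffun 'I_m.+1 -> 'I_B.+1} -> V) : (N <= B)%N ->
  \sum_(f : {ffun 'I_m.+1 -> 'I_B.+1} | (\sum_(i < m.+1) f i == N)%N) F f =
  \sum_(l < N.+1) \sum_(f : {ffun 'I_m -> 'I_B.+1} | (\sum_(i < m) f i == N - l)%N)
    F (fsnoc f (inord l)).
Proof.
move=> leNB.
rewrite (reindex (fun gt : {ffun 'I_m -> 'I_B.+1} * 'I_B.+1 => fsnoc gt.1 gt.2)) /=; last first.
  exists (fun f : {ffun 'I_m.+1 -> 'I_B.+1} =>
    ([ffun i => f (widen_ord (leqnSn m) i)], f ord_max)) => [[g t]|f] _ /=.
    by congr pair; [apply/ffunP => i; rewrite ffunE fsnoc_widen | rewrite fsnoc_max].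
  apply/ffunP => i; rewrite ffunE; case: unliftP => [j ->|->] //=.
  by rewrite ffunE; congr (f _); apply/val_inj; rewrite /= /bump leqNgt ltn_ord.
rewrite big_mkcond -(pair_bigA _ (fun (g : {ffun 'I_m -> 'I_B.+1}) (t : 'I_B.+1) =>
  if (\sum_(i < m.+1) fsnoc g t i == N)%N then F (fsnoc g t) else 0)) exchange_big /=.
pose H (l : nat) := \sum_(f : {ffun 'I_m -> 'I_B.+1} | (\sum_(i < m) f i == N - l)%N)
    F (fsnoc f (inord l)).
rewrite -[RHS]/(\sum_(l < N.+1) H l) (big_ord_widen B.+1 H) //.
rewrite [RHS]big_mkcond; apply: eq_bigr => l _; rewrite /H inord_val -big_mkcond /=.
have sumE (g : {ffun 'I_m -> 'I_B.+1}) : (\sum_(i < m.+1) fsnoc g l i = \sum_(i < m) g i + l)%N.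
  rewrite big_ord_recr /= fsnoc_max; congr (_ + _)%N.
  by apply: eq_bigr => i _; rewrite fsnoc_widen.
case: ltnP => leN; first by apply: eq_bigl => g; rewrite sumE -[RHS](eqn_add2r l) subnK.
by rewrite big_pred0 // => g; rewrite sumE; apply/eqP; lia.
Qed.

Variables (n0 M0 : nat) (R G : nat -> nat -> V).
Hypothesis R0 : forall M, (M <= M0)%N -> R 0 M = (M == 0)%:R.
Hypothesis G0 : forall l, G 0 l = 0.
Hypothesis R_rec : forall n M, (n <= n0)%N -> (M <= M0)%N ->
  R n M *+ n = \sum_(j < n.+1) \sum_(l < M.+1) R (n - j)%N (M - l)%N * G j l.

Definition prod_partial_sums m (j : {ffun 'I_m -> 'I_n0.+1}) : K :=
  \prod_(i < m) ((\sum_(l < m | (l <= i)%N) j l)%N)%:R.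

Definition mode_sum m (j : {ffun 'I_m -> 'I_n0.+1}) (M : nat) : V :=
  \sum_(r : {ffun 'I_m -> 'I_M0.+1} | (\sum_(i < m) r i == M)%N)
    \prod_(i < m) G (j i) (r i).

(* Positivity of the parts is not imposed: a part 0 contributes a factor G 0 = 0. *)
Definition comp_term (m n M : nat) : V :=
  \sum_(j : {ffun 'I_m -> 'I_n0.+1} | (\sum_(i < m) j i == n)%N)
    (prod_partial_sums j)^-1 *: mode_sum j M.

Lemma partial_sums_recr m (j : {ffun 'I_m -> 'I_n0.+1}) t :
  prod_partial_sums (fsnoc j t) = prod_partial_sums j * (\sum_(i < m) j i + t)%N%:R.
Proof.
rewrite /prod_partial_sums big_ord_recr /=; congr (_ * _%:R).
  apply: eq_bigr => i _; congr _%:R.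
  rewrite big_mkcond big_ord_recr /= leqNgt ltn_ord addn0 -big_mkcond /=.
  by apply: eq_bigr => l _; rewrite fsnoc_widen.
rewrite big_mkcond big_ord_recr /= leqnn fsnoc_max -big_mkcond /=; congr (_ + _)%N.
by apply: eq_big => [l|l _]; [rewrite ltnW | rewrite fsnoc_widen].
Qed.

Lemma mode_sum_recr m (j : {ffun 'I_m -> 'I_n0.+1}) t M : (M <= M0)%N ->
  mode_sum (fsnoc j t) M = \sum_(l < M.+1) mode_sum j (M - l) * G t l.
Proof.
move=> leM; rewrite /mode_sum sum_ffun_recr //; apply: eq_bigr => l _.
rewrite mulr_suml; apply: eq_bigr => r _; rewrite big_ord_recr /= !fsnoc_max inordK.
  by congr (_ * _); apply: eq_bigr => i _; rewrite !fsnoc_widen.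
by have := ltn_ord l; lia.
Qed.

Lemma mode_sum_eq0 m (j : {ffun 'I_m -> 'I_n0.+1}) M i :
  j i = 0%N :> nat -> mode_sum j M = 0.
Proof.
move=> ji; apply: big1 => r _; apply: (@prod_eq0 _ _ _ i); first exact: mem_index_enum.
by rewrite ji.
Qed.

Lemma comp_term_eq0 m n M : (n < m)%N -> comp_term m n M = 0.
Proof.
move=> ltnm; apply: big1 => j /eqP jn.
have [i /eqP ji|pos] := pickP (fun i => (j i : nat) == 0%N).
  by rewrite (mode_sum_eq0 _ ji) scaler0.
suff : (m <= n)%N by rewrite leqNgt ltnm.
rewrite -jn -[m in leqLHS]card_ord -sum1_card; apply: leq_sum => i _.
by rewrite lt0n pos.
Qed.

Lemma comp_term0 n M : comp_term 0 n M = ((n == 0) && (M == 0))%:R.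
Proof.
rewrite /comp_term; case: n => [|n]; last first.
  by rewrite big_pred0 // => j; rewrite big_ord0.
rewrite (big_pred1 [ffun=> ord0]) => [|j]; last first.
  by rewrite big_ord0 eqxx; apply/esym/eqP/ffunP; case.
rewrite /prod_partial_sums big_ord0 invr1 scale1r /mode_sum; case: M => [|M]; last first.
  by rewrite big_pred0 // => j; rewrite big_ord0.
rewrite (big_pred1 [ffun=> ord0]) ?big_ord0 // => j.
by rewrite big_ord0 eqxx; apply/esym/eqP/ffunP; case.
Qed.

(** The last partial sum is the whole sum [n]; multiplying by [n] cancels it, and the other
    denominators belong to the composition without its last part. *)
Lemma comp_termS m n M : (n <= n0)%N -> (M <= M0)%N ->
  comp_term m.+1 n M *+ n =
  \sum_(j < n.+1) \sum_(l < M.+1) comp_term m (n - j) (M - l) * G j l.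
Proof.
move=> len leM; rewrite /comp_term sum_ffun_recr // -sumrMnl; apply: eq_bigr => t _.
have lett : (t < n0.+1)%N by have := ltn_ord t; lia.
rewrite -sumrMnl; under [RHS]eq_bigr => l _ do rewrite mulr_suml.
rewrite exchange_big /=; apply: eq_bigr => j /eqP jn.
rewrite mode_sum_recr // partial_sums_recr jn inordK //.
(* A last part 0 is killed by [G0]; otherwise [n] is positive, hence invertible in [K]. *)
case: t lett jn => [[|t] /= ltt] lett jn.
  rewrite !big1 ?scaler0 ?mul0rn // => l _; by rewrite G0 mulr0.
rewrite subnK // -scaler_nat scalerA invfM mulrC -mulrA mulVf; last first.
  by case: n len ltt {jn} => // n *; exact: natr_neq0.
by rewrite mulr1 scaler_sumr; apply: eq_bigr => l _; rewrite scalerAl.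
Qed.

(** Strong induction suffices because [G0] removes j = 0, so that only smaller degrees occur on the
    right of [R_rec]. *)
Lemma solve_recursion n M : (n <= n0)%N -> (M <= M0)%N ->
  R n M = \sum_(m < n.+1) comp_term m n M.
Proof.
elim/ltn_ind: n M => -[_|n IH] M len leM.
  by rewrite big_ord_recl big_ord0 addr0 R0 // comp_term0 eqxx.
apply: (scalerI (natr_neq0 n)); rewrite !scaler_nat R_rec // -sumrMnl.
rewrite [RHS]big_ord_recl /= comp_term0 mul0rn add0r.
under [RHS]eq_bigr => m _ do rewrite /bump leq0n add1n comp_termS //.
rewrite [RHS]exchange_big /=; apply: eq_bigr => j _.
rewrite [RHS]exchange_big /=; apply: eq_bigr => l _; rewrite -mulr_suml.
case: j => [[|j] /= ltj]; first by rewrite !G0 !mulr0.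
rewrite IH; try lia; congr (_ * _).
(* Compositions with more parts than their degree contribute zero, so the sum over m extends to a
   common range. *)
rewrite (big_ord_widen n.+1 (fun m => comp_term m (n.+1 - j.+1) (M - l))); last by lia.
rewrite big_mkcond; apply: eq_bigr => m _; case: ltnP => // ltm.
by rewrite comp_term_eq0 //; lia.
Qed.
End Compositions.

(** * Twisted commutators and intertwining by q-exponentials *)

Section TwistedCommutators.
Variables (K : fieldType) (p : K) (V : algType K).

(* The exponent of p in the j-th step is the degree of the argument when a and x
   have degree 1. *)
Fixpoint tcoml (a x : V) (j : nat) : V :=
  if j is i.+1 then let v := tcoml a x i in a * v - p ^- j *: (v * a) else x.

Fixpoint tcomr (a x : V) (j : nat) : V :=
  if j is i.+1 then let v := tcomr a x i in v * a - p ^- j *: (a * v) else x.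

Lemma tcoml_comm (a x b : V) j :
  GRing.comm b a -> GRing.comm b x -> GRing.comm b (tcoml a x j).
Proof.
move=> ba bx; elim: j => //= j IH.
by apply: commrD; [|apply: commrN; rewrite /GRing.comm -scalerAr -scalerAl; congr (_ *: _)];
  apply: commrM.
Qed.

Lemma tcomr_comm (a x b : V) j :
  GRing.comm b a -> GRing.comm b x -> GRing.comm b (tcomr a x j).
Proof.
move=> ba bx; elim: j => //= j IH.
by apply: commrD; [|apply: commrN; rewrite /GRing.comm -scalerAr -scalerAl; congr (_ *: _)];
  apply: commrM.
Qed.

Lemma tcoml_self a j :
  tcoml a a j = (\prod_(i < j) (1 - p ^- i.+1)) *: a ^+ j.+1.
Proof.
elim: j => [|j IH] /=; first by rewrite big_ord0 scale1r.
rewrite IH big_ord_recr /= -scalerAr -scalerAl -exprS -exprSr scalerA -scalerBl.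
by congr (_ *: _); ring.
Qed.

Definition lmul_op (z w : V) : V := z * w.
Definition rmul_op (z w : V) : V := w * z.
Definition cross_op (a b w : V) : V := a * w * b + b * w * a.

Lemma lmul_op_linear z : linear (lmul_op z).
Proof. by move=> k u v; rewrite /lmul_op mulrDr scalerAr. Qed.
Lemma rmul_op_linear z : linear (rmul_op z).
Proof. by move=> k u v; rewrite /rmul_op mulrDl scalerAl. Qed.
Lemma cross_op_linear a b : linear (cross_op a b).
Proof.
move=> k u v; rewrite /cross_op !mulrDr !mulrDl -!scalerAr -!scalerAl scalerDr.
by rewrite addrACA.
Qed.
HB.instance Definition _ z := GRing.isLinear.Build K V V _ (lmul_op z) (lmul_op_linear z).
HB.instance Definition _ z := GRing.isLinear.Build K V V _ (rmul_op z) (rmul_op_linear z).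
HB.instance Definition _ a b := GRing.isLinear.Build K V V _ (cross_op a b) (cross_op_linear a b).

Section Pair.
Variables a b x y : V.
Hypotheses (ab : a * b = b * a) (xb : b * x = x * b) (ya : a * y = y * a).

(** Since [b] commutes with the chain X of [x] and [a] with the chain Y of [y], the product (aX -
    p^(-j) Xa)(bY - p^(-j) Yb) sorts into left multiplication, right multiplication and cross
    terms. *)
Lemma tcoml_qchain j : tcoml a x j * tcoml b y j =
  qchain p (lmul_op (a * b)) (rmul_op (a * b)) (cross_op a b) (x * y) j.
Proof.
elim: j => //= j <-.
have /esym bX : GRing.comm b (tcoml a x j) by apply: tcoml_comm.
have aY : GRing.comm a (tcoml b y j) by apply: tcoml_comm.
set X := tcoml a x j in bX *; set Y := tcoml b y j in aY *.
rewrite /lmul_op /rmul_op /cross_op mulrBl !mulrBr -!scalerAl -!scalerAr.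
rewrite scalerA opprB addrA scalerDr opprD !addrA.
have -> : a * X * (b * Y) = a * b * (X * Y) by rewrite mulrA -(mulrA a) bX !mulrA.
have -> : X * a * (b * Y) = b * (X * Y) * a.
  by rewrite mulrA -(mulrA X) ab !mulrA bX -!mulrA aY.
have -> : X * a * (Y * b) = X * Y * (a * b) by rewrite -!mulrA (mulrA a) aY !mulrA.
by rewrite !mulrA addrAC.
Qed.

(** Right commutators exchange the roles of [D] and [T] and keep the cross terms. *)
Lemma tcomr_qchain j : tcomr a x j * tcomr b y j =
  qchain p (rmul_op (a * b)) (lmul_op (a * b)) (cross_op a b) (x * y) j.
Proof.
elim: j => //= j <-.
have /esym bX : GRing.comm b (tcomr a x j) by apply: tcomr_comm.
have aY : GRing.comm a (tcomr b y j) by apply: tcomr_comm.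
set X := tcomr a x j in bX *; set Y := tcomr b y j in aY *.
rewrite /lmul_op /rmul_op /cross_op mulrBl !mulrBr -!scalerAl -!scalerAr.
rewrite scalerA opprB addrA scalerDr opprD !addrA.
have -> : a * X * (b * Y) = a * b * (X * Y) by rewrite mulrA -(mulrA a) bX !mulrA.
have -> : X * a * (b * Y) = b * (X * Y) * a.
  by rewrite mulrA -(mulrA X) ab !mulrA bX -!mulrA aY.
have -> : X * a * (Y * b) = X * Y * (a * b) by rewrite -!mulrA (mulrA a) aY !mulrA.
by rewrite !mulrA addrAC [X in X + _]addrAC.
Qed.
End Pair.
End TwistedCommutators.

(** * Coefficients of the q-exponential and of its logarithmic derivative *)

Section Constants.
Variables (K : fieldType) (p s : K) (ga eps : nat -> K).
Hypotheses (p_neq0 : p != 0) (p_expn1 : forall n, (0 < n)%N -> p ^+ n != 1).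
Hypothesis eps0 : eps 0%N = 1.
Hypothesis epsS : forall k, eps k.+1 * (1 - p ^+ k.+1) = s * eps k.
Hypothesis ga0 : ga 0%N * (1 - p) = s.
Hypothesis gaS : forall n,
  ga n.+1 * ((p ^+ n.+2 - 1) * (p ^+ n.+1 - 1)) = s * p ^+ n.+1 * p ^+ n.+1 * ga n.

Let one_sub_neq0 n : 1 - p ^+ n.+1 != 0.
Proof. by rewrite subr_eq0 eq_sym p_expn1. Qed.

Definition diag_coef j := ga j * (\prod_(i < j) (1 - p ^- i.+1)) ^+ 2.

(** Let E be the series with coefficients [eps]. Since E(pt) = (1 - st) E(t), the coefficients L_n
    of t E'(t)/E(t) satisfy L_n (1 - p^n) = s^n; thus [diag_coef j] is L_(j+1). *)
Lemma diag_coefE j : diag_coef j * (1 - p ^+ j.+1) = s ^+ j.+1.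
Proof.
elim: j => [|j IH]; first by rewrite /diag_coef big_ord0 expr1n mulr1 !expr1.
rewrite [RHS]exprS -IH /diag_coef big_ord_recr /=.
set X := \prod_(_ < _) _.
apply: (mulIf (one_sub_neq0 j)).
have := gaS j; set P := p ^+ j.+1; set g := ga j; set g' := ga j.+1.
have P0 : P != 0 by rewrite expf_neq0.
move=> E.
have -> : g' * (X * (1 - P^-1)) ^+ 2 * (1 - p ^+ j.+2) * (1 - P) =
  (g' * ((p ^+ j.+2 - 1) * (P - 1))) * (X * (1 - P^-1)) ^+ 2 by ring.
by rewrite E; field.
Qed.

(** This is the coefficient of t^n in E(pt)/(1 - st) = E(t). *)
Lemma eps_telescope n : \sum_(i < n.+1) p ^+ (n - i) * eps (n - i) * s ^+ i = eps n.
Proof.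
elim: n => [|n IH]; first by rewrite big_ord_recl big_ord0 eps0 !mulr1 addr0.
rewrite big_ord_recl subn0 mulr1.
under eq_bigr => i _ do rewrite subSS exprS mulrCA.
by rewrite -mulr_sumr IH -epsS; ring.
Qed.

Lemma log_derivative_coef n :
  \sum_(i < n.+1) diag_coef i * eps (n - i) = n.+1%:R * eps n.+1.
Proof.
elim: n => [|n IH].
  rewrite big_ord_recl big_ord0 addr0 /= mul1r; apply: (mulIf (one_sub_neq0 0)).
  by rewrite epsS mulrAC diag_coefE expr1.
apply: (mulIf (one_sub_neq0 n.+1)).
rewrite -mulrA epsS mulr_suml.
(* With P = p^(n+1-i), the factor 1 - p^(n+2) splits as (1 - P) + P (1 - p^(i+1)); the first part
   calls for [epsS], the second for [diag_coefE]. *)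
transitivity (\sum_(i < n.+2) diag_coef i * (eps (n.+1 - i) * (1 - p ^+ (n.+1 - i)))
  + \sum_(i < n.+2) p ^+ (n.+1 - i) * eps (n.+1 - i) * s ^+ i.+1).
  rewrite -big_split /=; apply: eq_bigr => i _.
  have -> : p ^+ n.+2 = p ^+ (n.+1 - i) * p ^+ i.+1.
    by rewrite -exprD; congr (_ ^+ _); have := ltn_ord i; lia.
  by rewrite -diag_coefE; ring.
rewrite big_ord_recr /= subnn subrr !mulr0 addr0.
under eq_bigr => i _ do rewrite subSn -1?ltnS // epsS mulrCA.
rewrite -mulr_sumr IH.
under [X in _ + X]eq_bigr => i _ do rewrite exprS mulrCA.
by rewrite -mulr_sumr eps_telescope -[n.+2]addn1 natrD; ring.
Qed.

Variable V : algType K.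

Section Intertwining.
Variables a b x y : V.
Hypotheses (ab : a * b = b * a) (xb : b * x = x * b) (ya : a * y = y * a).

(** This is [euler_sum_sym] for left and right multiplication by [a * b]; both commute with
    [cross_op] because [a] and [b] commute. *)
Lemma exp_intertwining N :
  \sum_(i < N.+1) (ga i * eps (N - i)) *:
     ((a * b) ^+ (N - i) * (tcoml p a x i * tcoml p b y i)) =
  \sum_(i < N.+1) (ga i * eps (N - i)) *:
     ((tcomr p a x i * tcomr p b y i) * (a * b) ^+ (N - i)).
Proof.
pose ep k := if k is l.+1 then eps l else 0.
have epS k : ep k.+1 * (1 - p ^+ k) = s * ep k.
  by case: k => [|k] /=; rewrite ?subrr ?mulr0 // epsS.
have iterl k w : iter k (lmul_op (a * b)) w = (a * b) ^+ k * w.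
  by elim: k => [|k /= ->]; rewrite ?mul1r // /lmul_op mulrA -exprS.
have iterr k w : iter k (rmul_op (a * b)) w = w * (a * b) ^+ k.
  by elim: k => [|k /= ->]; rewrite ?mulr1 // /rmul_op -mulrA -exprSr.
have lr v : lmul_op (a * b) (rmul_op (a * b) v) = rmul_op (a * b) (lmul_op (a * b) v).
  by rewrite /lmul_op /rmul_op !mulrA.
have aab : a * b * a = a * (a * b) by rewrite -mulrA -ab.
have bab : a * b * b = b * (a * b) by rewrite mulrA -ab.
have lU v : lmul_op (a * b) (cross_op a b v) = cross_op a b (lmul_op (a * b) v).
  by rewrite /lmul_op /cross_op mulrDr !mulrA aab bab !mulrA.
have rU v : rmul_op (a * b) (cross_op a b v) = cross_op a b (rmul_op (a * b) v).
  by rewrite /rmul_op /cross_op mulrDl -!mulrA -aab -bab !mulrA.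
have := @euler_sum_sym K p s ga ep p_neq0 p_expn1 erefl epS gaS V
  (lmul_op (a * b)) (rmul_op (a * b)) (cross_op a b) (x * y) N.+1 lr lU rU.
(* The last term of each sum carries [ep 0 = 0], so the symmetry at [N.+1] yields sums up to [N]. *)
rewrite /euler_sum ![\sum_(_ < N.+2) _]big_ord_recr /= subnn.
rewrite /euler_term /= !mulr0 !scale0r !addr0 => E.
have subS (i : 'I_N.+1) : (N.+1 - i = (N - i).+1)%N by rewrite subSn // -ltnS.
transitivity (\sum_(i < N.+1) (ga i * ep (N.+1 - i)%N) *: iter (N.+1 - i).-1
     (lmul_op (a * b)) (qchain p (lmul_op (a * b)) (rmul_op (a * b)) (cross_op a b) (x * y) i)).
  by apply: eq_bigr => i _; rewrite subS /= iterl tcoml_qchain.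
by rewrite E; apply: eq_bigr => i _; rewrite subS /= iterr tcomr_qchain.
Qed.
End Intertwining.

(** On the diagonal the twisted commutators are multiples of powers, and only the scalar identity
    remains. *)
Lemma exp_log_derivative (a b : V) N : a * b = b * a ->
  \sum_(i < N.+1) (ga i * eps (N - i)) *:
     ((a * b) ^+ (N - i) * (tcoml p a a i * tcoml p b b i)) =
  (N.+1%:R * eps N.+1) *: (a * b) ^+ N.+1.
Proof.
move=> ab; rewrite -log_derivative_coef scaler_suml; apply: eq_bigr => i _.
rewrite !tcoml_self -!(scalerAl, scalerAr) -(exprMn_comm _ ab) -exprD !scalerA.
have -> : (N - i + i.+1 = N.+1)%N by have := ltn_ord i; lia.
by rewrite /diag_coef; congr (_ *: _); ring.
Qed.

(** * Twisted commutators of a family with a quadratic relation *)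

Section Current.
Variable x : nat -> V.
Hypothesis two_neq0 : (2%:R : K) != 0.
Hypothesis rel_x : forall m n,
  x m.+1 * x n - p^-1 *: (x m * x n.+1) = p^-1 *: (x n * x m.+1) - x n.+1 * x m.

(** At m = n the quadratic relation equates an element with its opposite, and 2 is invertible. *)
Lemma current_succ a : x a.+1 * x a = p^-1 *: (x a * x a.+1).
Proof.
have := rel_x a a; rewrite -[RHS]opprB => E.
apply/eqP; rewrite -subr_eq0 -(inj_eq (scalerI two_neq0)) scaler0.
by rewrite scaler_nat mulr2n {1}E addNr.
Qed.

(** The exponents follow the degree of the argument; the terms with both twisting elements on one
    side match by [current_succ]. *)
Lemma tcom_swap a v d :
  let l := fun d w => x a.+1 * w - p ^- d *: (w * x a.+1) in
  let r := fun d w => w * x a - p ^- d *: (x a * w) in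
  r d.+2 (l d.+1 v) = l d.+2 (r d.+1 v).
Proof.
move=> l r; rewrite /l /r !(mulrBl, mulrBr) -!(scalerAl, scalerAr) !scalerBr.
rewrite !mulrA current_succ -!(mulrA v) current_succ -!(scalerAl, scalerAr) !scalerA.
have -> : p ^- d.+1 / p = p ^- d.+2 by rewrite -invfM -exprSr.
by rewrite !opprB !addrA addrAC [RHS]addrAC; congr (_ + _); rewrite addrAC.
Qed.

Lemma tcomr_tcoml a v w j :
  v * x a - p ^- 1 *: (x a * v) = - (x a.+1 * w - p ^- 1 *: (w * x a.+1)) ->
  let u := tcoml p (x a.+1) v j in
  u * x a - p ^- j.+1 *: (x a * u) = - tcoml p (x a.+1) w j.+1.
Proof.
move=> vw; elim: j => [|j IH] //.
have := tcom_swap a (tcoml p (x a.+1) v j) j => /= ->; rewrite IH.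
by rewrite mulrN mulNr scalerN opprB opprK addrC.
Qed.

(** The relation [rel_x m a] trades one right commutator of [x m.+1] with [x a] for minus a left
    commutator of [x m] with [x a.+1]. The trade passes through the remaining left commutators by
    [tcom_swap]. *)
Lemma tcomr_shift a m j :
  tcomr p (x a) (x (m + j)) j = (-1) ^+ j *: tcoml p (x a.+1) (x m) j.
Proof.
elim: j m => [|j IH] m; first by rewrite addn0 scale1r.
rewrite /= addnS -addSn IH -scalerAl -scalerAr scalerA mulrC -scalerA -scalerBr.
rewrite (@tcomr_tcoml a _ (x m)).
  by rewrite exprSr -scalerA scaleN1r.
have /eqP := rel_x m a; rewrite subr_eq => /eqP ->.
by rewrite opprB addrAC [X in X + _]addrAC subrr add0r addrC.
Qed.

(** For j = i, [tcomr_shift] leads to left commutators of [x a] with [x a.+1], whose first step is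
    zero by [current_succ]. *)
Lemma tcomr_eq0 a i j : (0 < i <= j)%N -> tcomr p (x a) (x (a + i)) j = 0.
Proof.
case/andP=> i0 /subnKC <-; elim: (j - i)%N => [|k IH].
  rewrite addn0 tcomr_shift; case: i i0 => // i _.
  suff -> : tcoml p (x a.+1) (x a) i.+1 = 0 by rewrite scaler0.
  elim: i => [|i IH] /=; first by rewrite current_succ subrr.
  by move: IH => /= ->; rewrite mulr0 mul0r scaler0 subrr.
by rewrite addnS /= IH mulr0 mul0r scaler0 subrr.
Qed.
End Current.

(** * Logarithmic derivative of an ordered product of q-exponentials *)

Section Factorization.
Variables x y : nat -> V.
Hypothesis two_neq0 : (2%:R : K) != 0.
Hypothesis rel_x : forall m n,
  x m.+1 * x n - p^-1 *: (x m * x n.+1) = p^-1 *: (x n * x m.+1) - x n.+1 * x m.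
Hypothesis rel_y : forall m n,
  y m.+1 * y n - p^-1 *: (y m * y n.+1) = p^-1 *: (y n * y m.+1) - y n.+1 * y m.
Hypothesis xy_comm : forall m n, x m * y n = y n * x m.

(* The component of degree [n] and mode [M] of the logarithmic derivative of
   the product of the factors of mode at least [a]. *)
Definition log_term (a n M : nat) : V :=
  if n is j.+1 then
    if (n * a <= M)%N then
      ga j *: (tcoml p (x a) (x (M - j * a)) j * tcoml p (y a) (y (M - j * a)) j)
    else 0
  else 0.

(** The two signs from [tcomr_shift] cancel. The range on the right is wider, but the additional
    modes vanish by [tcomr_eq0]. *)
Lemma log_term_tcomr a j M :
  log_term a.+1 j.+1 M =
  if (j.+1 * a < M)%N then
    ga j *: (tcomr p (x a) (x (M - j * a)) j * tcomr p (y a) (y (M - j * a)) j)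
  else 0.
Proof.
rewrite /log_term; case: ifP => [leM|/negbT].
  have -> : (j.+1 * a < M)%N by nia.
  have -> : (M - j * a = M - j * a.+1 + j)%N by nia.
  rewrite !tcomr_shift // -scalerAl -scalerAr !scalerA -mulrA -expr2.
  by rewrite sqrr_sign mulr1.
rewrite -ltnNge => ltM; case: ifP => // lt_aM.
(* In this range M - ja exceeds a by an amount between 1 and j. *)
rewrite (_ : (M - j * a)%N = (a + (M - j.+1 * a))%N); last by nia.
by rewrite tcomr_eq0 ?mul0r ?scaler0 //; nia.
Qed.

Arguments log_term : simpl never.

Variables n0 M0 : nat.

(* The outer variable records the degree and the inner one the mode. *)
Definition factor (a : nat) : {poly {poly V}} :=
  \poly_(k < n0.+1) ((eps k *: (x a * y a) ^+ k) *: 'X^(k * a)).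

Definition log_poly (a : nat) : {poly {poly V}} :=
  \poly_(n < n0.+1) \poly_(M < M0.+1) log_term a n M.

Lemma coef_factor a n : (n <= n0)%N ->
  (factor a)`_n = (eps n *: (x a * y a) ^+ n) *: 'X^(n * a).
Proof. by move=> len; rewrite coef_poly ltnS len. Qed.

Lemma coef_log_poly a n M : (n <= n0)%N -> (M <= M0)%N ->
  (log_poly a)`_n`_M = log_term a n M.
Proof. by move=> len leM; rewrite coef_poly ltnS len coef_poly ltnS leM. Qed.

Lemma log_poly0 a : (log_poly a)`_0 = 0.
Proof. by apply/polyP => i; rewrite coef_poly /= coef_poly coef0 /log_term; case: ifP. Qed.

Lemma coef_monomM (c : V) w (Q : {poly V}) M :
  ((c *: 'X^w) * Q)`_M = if (w <= M)%N then c * Q`_(M - w) else 0.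
Proof. by rewrite -scalerAl coefZ coefXnM ltnNge; case: leqP; rewrite ?mulr0. Qed.

Lemma coef_Mmonom (c : V) w (Q : {poly V}) M :
  (Q * (c *: 'X^w))`_M = if (w <= M)%N then Q`_(M - w) * c else 0.
Proof.
by rewrite -mul_polyC mulrA coefMXn ltnNge; case: leqP => //=; rewrite coefMC.
Qed.

Lemma factor_step a n M : (n <= n0)%N -> (M <= M0)%N ->
  (factor a * log_poly a)`_n`_M =
  (log_poly a.+1 * factor a + 'X * (factor a)^`())`_n`_M.
Proof.
case: n => [|n] len leM.
  rewrite coefD coefXM addr0 !coefM !big_ord_recl !big_ord0 !addr0 subn0.
  by rewrite !log_poly0 mulr0 mul0r.
have lek (i : 'I_n.+1) : (n - i <= n0)%N by have := ltn_ord i; lia.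
have lei (i : 'I_n.+1) : (i.+1 <= n0)%N by have := ltn_ord i; lia.
rewrite coefMr coefD coefXM /= coefD coef_deriv coefM ![\sum_(_ < n.+2) _]big_ord_recl.
rewrite !log_poly0 mulr0 mul0r !add0r.
rewrite !coef_sum /=.
under eq_bigr => i _.
  rewrite /bump leq0n add1n subSS coef_factor ?lek // coef_monomM.
  rewrite (fun h => coef_log_poly _ (lei i) h); last by lia.
  over.
under [X in _ = X + _]eq_bigr => i _.
  rewrite /bump leq0n add1n subSS coef_factor ?lek // coef_Mmonom.
  rewrite (fun h => coef_log_poly _ (lei i) h); last by lia.
  over.
rewrite coef_factor //= coefMn coefZ coefXn.
have xy_a : x a * y a = y a * x a by [].
(* The mode left for x and y is the same in every summand, so a single pair enters the identity. *)
have idx (i : 'I_n.+1) : (M - (n - i) * a - i * a = M - n * a)%N.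
  by rewrite -subnDA -mulnDl subnK // -ltnS.
(* The remaining mode M - na is compared with a: above it, intertwining applies; below it, every
   term vanishes; at equality, only the left side and the derivative survive. *)
have [ltM|gtM|eqM] := ltngtP (n.+1 * a)%N M.
- rewrite mulr0 mul0rn addr0.
  have := @exp_intertwining (x a) (y a) (x (M - n * a)) (y (M - n * a)) xy_a.
  move=> /(_ _ _ n) E.
  transitivity (\sum_(i < n.+1) (ga i * eps (n - i)) *:
     ((x a * y a) ^+ (n - i) * (tcoml p (x a) (x (M - n * a)) i *
        tcoml p (y a) (y (M - n * a)) i))).
    apply: eq_bigr => i _; have lti := ltn_ord i.
    have -> : ((n - i) * a <= M)%N by nia.
    rewrite /log_term idx; have -> : (i.+1 * a <= M - (n - i) * a)%N by nia.
    by rewrite -scalerAl -scalerAr scalerA mulrC.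
  rewrite E //; apply: eq_bigr => i _; have lti := ltn_ord i.
  have -> : ((n - i) * a <= M)%N by nia.
  rewrite log_term_tcomr idx; have -> : (i.+1 * a < M - (n - i) * a)%N by nia.
  by rewrite -scalerAl -scalerAr scalerA.
- rewrite mulr0 mul0rn addr0 !big1 // => i _; case: ifP => // _.
    rewrite log_term_tcomr; case: ifP; rewrite ?mul0r // => ?.
    by have := ltn_ord i; nia.
  rewrite /log_term; case: ifP; rewrite ?mulr0 // => ?.
  by have := ltn_ord i; nia.
have Mn : (M - n * a = a)%N by nia.
rewrite [X in _ = X + _]big1 ?add0r; last first.
  move=> i _; case: ifP => // _.
  rewrite log_term_tcomr; case: ifP; rewrite ?mul0r // => ?.
  by have := ltn_ord i; nia.
rewrite mulr1 -scaler_nat scalerA -exp_log_derivative //.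
apply: eq_bigr => i _; have lti := ltn_ord i.
have -> : ((n - i) * a <= M)%N by nia.
rewrite /log_term idx Mn; have -> : (i.+1 * a <= M - (n - i) * a)%N by nia.
by rewrite -scalerAl -scalerAr scalerA mulrC.
Qed.

Definition eq_trunc (P Q : {poly {poly V}}) := forall n M,
  (n <= n0)%N -> (M <= M0)%N -> P`_n`_M = Q`_n`_M.

Lemma eq_truncM P P' Q Q' :
  eq_trunc P P' -> eq_trunc Q Q' -> eq_trunc (P * Q) (P' * Q').
Proof.
move=> eP eQ n M len leM; rewrite !coefM !coef_sum; apply: eq_bigr => i _.
rewrite !coefM; apply: eq_bigr => j _; have lti := ltn_ord i; have ltj := ltn_ord j.
by rewrite eP ?eQ //; lia.
Qed.

Lemma eq_truncD P P' Q Q' :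
  eq_trunc P P' -> eq_trunc Q Q' -> eq_trunc (P + Q) (P' + Q').
Proof. by move=> eP eQ n M len leM; rewrite !coefD eP ?eQ. Qed.

Definition ordered_prod (a k : nat) : {poly {poly V}} :=
  \prod_(i <- rev (iota a k)) factor i.

(** The descending induction starts at a = M0+1, where the product is empty and every logarithmic
    term has mode above M0. *)
Lemma ordered_prod_deriv a k : (a + k = M0.+1)%N ->
  eq_trunc ('X * (ordered_prod a k)^`()) (ordered_prod a k * log_poly a).
Proof.
rewrite /ordered_prod; elim: k a => [|k IH] a Dk.
  move=> n M len leM; rewrite /= big_nil derivC mulr0 mul1r coef_log_poly //.
  rewrite !coef0 /log_term; case: n len => // j _.
  by case: ifP => //; nia.
have {IH} IH := IH a.+1; rewrite /= rev_cons big_rcons /=.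
set P := \big[_/_]_(_ <- _) _ in IH *.
have XP : 'X * P = P * 'X by rewrite commr_polyX.
rewrite derivM mulrDr mulrA [X in _ + X]mulrA XP -!mulrA.
move=> n M len leM.
transitivity (P * (log_poly a.+1 * factor a + 'X * (factor a)^`()))`_n`_M.
  rewrite mulrDr; apply: eq_truncD => //.
  by rewrite !mulrA; apply: eq_truncM => //; apply: IH; lia.
apply: eq_truncM => // n' M' len' leM'.
by rewrite factor_step.
Qed.

Lemma ordered_prod_rec a k n M : (a + k = M0.+1)%N -> (n <= n0)%N -> (M <= M0)%N ->
  (ordered_prod a k)`_n`_M *+ n =
  \sum_(j < n.+1) \sum_(l < M.+1)
    (ordered_prod a k)`_(n - j)`_(M - l) * log_term a j l.
Proof.
move=> Dk len leM; have := ordered_prod_deriv Dk len leM.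
have -> : ('X * (ordered_prod a k)^`())`_n`_M = (ordered_prod a k)`_n`_M *+ n.
  by rewrite coefXM; case: n len => [|n] len; rewrite ?coef0 //= coef_deriv coefMn.
move=> ->; rewrite coefMr coef_sum; apply: eq_bigr => j _; rewrite coefMr.
apply: eq_bigr => l _; rewrite coef_log_poly //.
  by have := ltn_ord j; lia.
by have := ltn_ord l; lia.
Qed.

Lemma scale_polyXnM (A : nzRingType) (c c' : A) n m :
  (c *: 'X^n) * (c' *: 'X^m) = (c * c') *: 'X^(n + m).
Proof.
by rewrite -scalerAl -[c' *: _]mul_polyC mulrA -commr_polyXn -mulrA -exprD mul_polyC scalerA.
Qed.

Lemma coef_ordered_prod a k n M : (n <= n0)%N ->
  (ordered_prod a k)`_n`_M =
  \sum_(f : {ffun 'I_k -> 'I_n0.+1} |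
      ((\sum_(i < k) (f i : nat))%N == n) && ((\sum_(i < k) ((a + i) * f i))%N == M))
    \prod_(i <- rev (enum 'I_k)) (eps (f i) *: (x (a + i) * y (a + i)) ^+ f i).
Proof.
move=> len; pose bimono (c : V) w d : {poly {poly V}} := (c *: 'X^w) *: 'X^d.
have bimonoM c w d c' w' d' :
    bimono c w d * bimono c' w' d' = bimono (c * c') (w + w')%N (d + d')%N.
  by rewrite /bimono !scale_polyXnM.
have prod_bimono (c : 'I_k -> V) (w d : 'I_k -> nat) s' :
    \prod_(i <- s') bimono (c i) (w i) (d i) =
    bimono (\prod_(i <- s') c i) (\sum_(i <- s') w i)%N (\sum_(i <- s') d i)%N.
  elim: s' => [|i s' IH]; first by rewrite !big_nil /bimono !expr0 !scale1r.
  by rewrite !big_cons IH bimonoM.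
have -> : ordered_prod a k = \prod_(i <- rev (enum 'I_k)) \sum_(j < n0.+1)
    bimono (eps j *: (x (a + i) * y (a + i)) ^+ j) (j * (a + i))%N j.
  rewrite /ordered_prod -[a in iota a]addn0 iotaDl -val_enum_ord -map_comp -map_rev.
  by rewrite big_map; apply: eq_bigr => i _; rewrite /factor poly_def.
have enumE : enum 'I_k = index_enum 'I_k by rewrite /index_enum enumT locked_withE.
rewrite -rev_prodr enumE bigA_distr_bigA /=.
under eq_bigr => f _ do rewrite rev_prodr prod_bimono.
rewrite !coef_sum [RHS]big_mkcond; apply: eq_bigr => f _.
rewrite !coefZ !coefXn !big_rev /=.
rewrite eq_sym; case: eqP => _; last by rewrite mulr0 coef0.
rewrite mulr1 coefZ coefXn eq_sym.
rewrite (eq_bigr (fun i : 'I_k => (a + i) * f i)%N) => [|i _]; last exact: mulnC.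
by case: eqP => _; rewrite ?mulr1 ?mulr0.
Qed.

Lemma ordered_exp_formula a k : (forall i, (i.+1%:R : K) != 0) -> (a + k = M0.+1)%N ->
  \sum_(f : {ffun 'I_k -> 'I_n0.+1} |
      ((\sum_(i < k) (f i : nat))%N == n0) && ((\sum_(i < k) ((a + i) * f i))%N == M0))
    \prod_(i <- rev (enum 'I_k)) (eps (f i) *: (x (a + i) * y (a + i)) ^+ f i) =
  \sum_(m < n0.+1) comp_term n0 M0 (log_term a) m n0 M0.
Proof.
move=> natr_neq0 Dk; rewrite -coef_ordered_prod //.
apply: (@solve_recursion _ _ natr_neq0 n0 M0
  (fun n M => (ordered_prod a k)`_n`_M) (log_term a)) => //.
- move=> M leM; rewrite coef_ordered_prod //.
  have f0 (f : {ffun 'I_k -> 'I_n0.+1}) :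
      (\sum_(i < k) (f i : nat))%N == 0%N -> f = [ffun=> ord0].
    rewrite sum_nat_eq0 => /forallP f0; apply/ffunP => i; apply/val_inj.
    by rewrite ffunE /= (eqP (f0 i)).
  have sum0 (w : 'I_k -> nat) :
      (\sum_(i < k) w i * ([ffun=> ord0] : {ffun 'I_k -> 'I_n0.+1}) i = 0)%N.
    by apply: big1 => i _; rewrite ffunE muln0.
  case: M leM => [|M] leM.
    rewrite (big_pred1 [ffun=> ord0]) => [|f].
      by rewrite big1_seq // => i _; rewrite ffunE expr0 eps0 scale1r.
    apply/andP/eqP => [[/f0] //|->]; rewrite sum0 eqxx; split => //.
    by rewrite big1 // => i _; rewrite ffunE.
  by rewrite big_pred0 // => f; apply/andP => -[/f0 ->]; rewrite sum0.
by move=> n M len leM; apply: ordered_prod_rec.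
Qed.
End Factorization.
End Constants.

(** * Compositions in the converse algebra *)

Section Converse.
Variables (K : fieldType) (V : algType K).

HB.instance Definition _ := GRing.Lmodule.copy V^c V.

(* The casts to V^c matter: without them the product is taken in V. *)
Lemma converse_scalerAl (k : K) (u v : V^c) : k *: (u * v) = (k *: u : V^c) * v.
Proof. exact (@scalerAr K V k v u). Qed.
HB.instance Definition _ := GRing.Lmodule_isLalgebra.Build K V^c converse_scalerAl.

Lemma converse_scalerAr (k : K) (u v : V^c) : k *: (u * v) = u * (k *: v : V^c).
Proof. exact (@scalerAl K V k v u). Qed.
HB.instance Definition _ := GRing.Lalgebra_isAlgebra.Build K V^c converse_scalerAr.

Lemma tcoml_converse (p : K) (a x : V) j : tcoml p (a : V^c) x j = tcomr p a x j.
Proof. by elim: j => //= j ->. Qed.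

(** Reversing a composition restores the order of the product and turns initial partial sums into
    final ones, the denominators of [Cminus]. *)
Lemma comp_term_converse n0 M0 (G : nat -> nat -> V) m n M :
  comp_term n0 M0 (G : nat -> nat -> V^c) m n M =
  \sum_(j : {ffun 'I_m -> 'I_n0.+1} | (\sum_(i < m) j i == n)%N)
    (\prod_(i < m) ((\sum_(l < m | (i <= l)%N) j l)%N%:R : K))^-1 *: mode_sum M0 G j M.
Proof.
pose frev B (f : {ffun 'I_m -> 'I_B}) : {ffun 'I_m -> 'I_B} := [ffun i => f (rev_ord i)].
have frevK B : involutive (@frev B).
  by move=> f; apply/ffunP => i; rewrite !ffunE rev_ordK.
have frev_sum B (f : {ffun 'I_m -> 'I_B}) : (\sum_(i < m) frev B f i = \sum_(i < m) f i)%N.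
  by rewrite (reindex_inj rev_ord_inj); apply: eq_bigr => i _; rewrite ffunE rev_ordK.
have rev_index : rev (index_enum 'I_m) = map (@rev_ord m) (index_enum 'I_m).
  have -> : index_enum 'I_m = enum 'I_m by rewrite /index_enum enumT locked_withE.
  apply: (inj_map val_inj); rewrite map_rev val_enum_ord -map_comp.
  apply: (@eq_from_nth _ 0%N); first by rewrite size_rev size_map size_iota size_enum_ord.
  move=> i; rewrite size_rev size_iota => lti.
  rewrite nth_rev ?size_iota // nth_iota; last by lia.
  rewrite (nth_map (Ordinal lti)) ?size_enum_ord //= nth_enum_ord //; lia.
rewrite /comp_term (reindex_inj (inv_inj (@frevK _))) /=.
apply: eq_big => [j|j _]; first by rewrite frev_sum.
congr (_^-1 *: _).
  rewrite /prod_partial_sums (reindex_inj rev_ord_inj) /=; apply: eq_bigr => i _; congr _%:R.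
  rewrite (reindex_inj rev_ord_inj) /=; apply: eq_big => [l|l _].
    by have := ltn_ord l; have := ltn_ord i; lia.
  by rewrite ffunE rev_ordK.
rewrite /mode_sum (reindex_inj (inv_inj (@frevK _))) /=.
apply: eq_big => [r|r _]; first by rewrite frev_sum.
rewrite (rev_prodr (index_enum _)) rev_index big_map.
by apply: eq_bigr => i _; rewrite !ffunE rev_ordK.
Qed.
End Converse.

(** * The two factors of the R-matrix *)

Section RMatrix.
Variables (K : fieldType) (q : K).
Hypotheses (q_neq0 : q != 0) (q_expn1 : forall n, (0 < n)%N -> q ^+ n != 1).
Hypothesis natr_neq0 : forall n, (n.+1%:R : K) != 0.

Let p := q ^+ 2.
Let u := q^-1 - q.

Definition exp_coef (k : nat) : K := u ^+ k / qparfact q k.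
(** Here j is n - 1; the power of q is the one produced by [iter_Se]. *)
Definition log_coef (j : nat) : K := q ^+ (j * j.+1) * u / (qfact q j.+1 * qfact q j).

Let p_neq0 : p != 0. Proof. by rewrite expf_neq0. Qed.

Let p_expn1 n : (0 < n)%N -> p ^+ n != 1.
Proof. by move=> n0; rewrite -exprM q_expn1 // muln_gt0. Qed.

Let p_sub1 n : p ^+ n.+1 - 1 != 0.
Proof. by rewrite subr_eq0 p_expn1. Qed.

Lemma u_neq0 : u != 0.
Proof.
have := p_sub1 0; apply: contraNneq => u0.
have -> : p ^+ 1 - 1 = - q * u by rewrite /p /u expr1; field.
by rewrite u0 mulr0.
Qed.

Lemma qpar_neq0 n : qpar q n.+1 != 0.
Proof.
by rewrite /qpar exprM mulf_neq0 ?p_sub1 // invr_neq0 // -[q ^+ 2]expr1 p_sub1.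
Qed.

Lemma qparfactS n : qparfact q n.+1 = qparfact q n * qpar q n.+1.
Proof. by rewrite /qparfact big_nat_recr. Qed.

Lemma qparfact_neq0 n : qparfact q n != 0.
Proof.
elim: n => [|n IH]; first by rewrite /qparfact big_nil oner_neq0.
by rewrite qparfactS mulf_neq0 ?qpar_neq0.
Qed.

Lemma qintE n : qint q (Posz n) = (p ^+ n - 1) / (q ^+ n * - u).
Proof.
rewrite /qint -exprnP -exprnN /p -exprM mulnC exprM.
have qn : q ^+ n != 0 by rewrite expf_neq0.
have := u_neq0; rewrite /u => u0.
have qq : q - q^-1 != 0 by rewrite -opprB oppr_eq0.
rewrite invfM mulrA; congr (_ / _); last by rewrite opprB.
by field.
Qed.

Lemma qint_neq0 n : qint q (Posz n.+1) != 0.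
Proof.
by rewrite qintE mulf_neq0 ?p_sub1 // invr_neq0 // mulf_neq0 ?expf_neq0 // oppr_eq0 u_neq0.
Qed.

Lemma qfactS n : qfact q n.+1 = qfact q n * qint q (Posz n.+1).
Proof. by rewrite /qfact big_nat_recr. Qed.

Lemma qfact0 : qfact q 0 = 1.
Proof. by rewrite /qfact big_nil. Qed.

Lemma qfact_neq0 n : qfact q n != 0.
Proof.
elim: n => [|n IH]; first by rewrite qfact0 oner_neq0.
by rewrite qfactS mulf_neq0 ?qint_neq0.
Qed.

Lemma exp_coef0 : exp_coef 0 = 1.
Proof. by rewrite /exp_coef /qparfact big_nil invr1 mulr1. Qed.

Lemma exp_coefS k : exp_coef k.+1 * (1 - p ^+ k.+1) = ((1 - p) * u) * exp_coef k.
Proof.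
rewrite /exp_coef qparfactS /qpar exprM -/p exprS.
have p1 : p - 1 != 0 by have := p_sub1 0.
have := p_sub1 k; have := qparfact_neq0 k.
by set P := p ^+ k.+1; set F := qparfact q k => F0 P0; field; rewrite F0 p1 P0.
Qed.

Lemma log_coef0 : log_coef 0 * (1 - p) = (1 - p) * u.
Proof.
rewrite /log_coef qfactS qfact0 mul0n expr0 !mul1r mulr1.
rewrite (_ : qint q 1 = 1) ?divr1 1?mulrC //.
by rewrite /qint expr1z exprN1 divff // -opprB oppr_eq0 u_neq0.
Qed.

Lemma log_coefS j :
  log_coef j.+1 * ((p ^+ j.+2 - 1) * (p ^+ j.+1 - 1)) =
  ((1 - p) * u) * p ^+ j.+1 * p ^+ j.+1 * log_coef j.
Proof.
(* Since 1 - p = q u, the parameter s is expressed through the same u as the q-integers in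
   [qintE]. *)
have -> : (1 - p) * u = q * u ^+ 2.
  by rewrite /p expr2 mulrA; congr (_ * _); rewrite /u; field.
rewrite /log_coef !qfactS !qintE.
have := qfact_neq0 j; set F := qfact q j => F0.
have qj : q ^+ j != 0 by rewrite expf_neq0.
have -> : q ^+ (j.+1 * j.+2) = q ^+ (j * j.+1) * (q ^+ j * q ^+ j * q ^+ 2).
  by rewrite -!exprD; congr (_ ^+ _); lia.
have pjE i : p ^+ i = q ^+ i * q ^+ i by rewrite /p -exprM mul2n -addnn exprD.
have := p_sub1 j; have := p_sub1 j.+1.
rewrite !(exprS p j.+1) !(exprS p j) !(pjE j) !(exprS q j.+1) !(exprS q j) /p expr2.
have := u_neq0; move: (q ^+ j) qj => Q qj; move: (q ^+ (j * j.+1)) => Z.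
move: u => v v0 A B.
by field; rewrite oppr_eq0 v0 qj q_neq0 F0 A B.
Qed.

Section Split.
Variable V : algType K.

Lemma prod_mul_comm (I : Type) (r : seq I) (A B : I -> V) :
  (forall i j, A i * B j = B j * A i) ->
  \prod_(i <- r) (A i * B i) = (\prod_(i <- r) A i) * (\prod_(i <- r) B i).
Proof.
move=> AB; elim: r => [|i r IH]; first by rewrite !big_nil mulr1.
rewrite !big_cons IH -!mulrA; congr (_ * _); rewrite !mulrA; congr (_ * _).
by apply: commr_prod => j _; apply/esym/AB.
Qed.

Variables (n M : nat) (G A B : nat -> nat -> V).
Hypothesis G0 : forall r, G 0 r = 0.
Hypothesis GS : forall j r,
  G j.+1 r = ((-1) ^+ j.+1 * u / (qfact q j.+1 * qfact q j)) *: (A j r * B j r).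
Hypothesis AB_comm : forall j r j' r', A j r * B j' r' = B j' r' * A j r.

(** The denominator is left arbitrary so that the lemma serves both the initial and the final
    partial sums. *)
Lemma sum_mode_sum m (den : {ffun 'I_m -> 'I_n.+1} -> K) :
  \sum_(j : {ffun 'I_m -> 'I_n.+1} | (\sum_(i < m) j i == n)%N)
    (den j)^-1 *: mode_sum M G j M =
  \sum_(j : {ffun 'I_m -> 'I_n.+1} |
      [forall i, 0 < (j i : nat)]%N && ((\sum_(i < m) (j i : nat))%N == n))
    ((-1) ^+ n * (u ^+ m / den j * qfact_prod q (fun i => (j i : nat)))) *:
    \sum_(r : {ffun 'I_m -> 'I_M.+1} | (\sum_(i < m) (r i : nat))%N == M)
      ((\prod_(i < m) A (j i).-1 (r i)) * (\prod_(i < m) B (j i).-1 (r i))).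
Proof.
rewrite big_mkcond [RHS]big_mkcond; apply: eq_bigr => j _.
have [jn|_] := eqVneq (\sum_(i < m) j i)%N n; last by rewrite andbF.
rewrite andbT; case: ifPn => [/forallP pos|]; last first.
  case/forallPn => i; rewrite -leqNgt leqn0 => /eqP ji.
  by rewrite (mode_sum_eq0 _ G0 _ ji) scaler0.
have jS i : j i = (j i).-1.+1 :> nat by rewrite prednK.
have GE r : \prod_(i < m) G (j i) (r i) =
    ((-1) ^+ n * u ^+ m * qfact_prod q (fun i => (j i : nat))) *:
    ((\prod_(i < m) A (j i).-1 (r i)) * (\prod_(i < m) B (j i).-1 (r i))).
  rewrite -prod_mul_comm => [|i i']; last exact: AB_comm.
  transitivity (\prod_(i < m) (((-1) ^+ j i * u * (qfact q (j i) * qfact q (j i).-1)^-1) *: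
      (A (j i).-1 (r i) * B (j i).-1 (r i)))).
    by apply: eq_bigr => i _; rewrite [in LHS]jS GS -jS.
  rewrite scaler_prod; congr (_ *: _).
  by rewrite !big_split /= prodr_const card_ord -expr_sum jn.
rewrite /mode_sum; under eq_bigr => r _ do rewrite GE.
rewrite -scaler_sumr scalerA; congr (_ *: _); ring.
Qed.
End Split.

Variable W : algType K.

(** * Screening operators as twisted commutators *)

Section Screening.
Variable rho : UqRep q W.

Lemma conjk_mul (a b : W) :
  kk rho * (a * b) * ki rho = (kk rho * a * ki rho) * (kk rho * b * ki rho).
Proof. by rewrite -!mulrA (mulrA (ki rho)) k_inv_r mul1r !mulrA. Qed.

(** Conjugation by k is multiplicative, and the commutator has degree [j.+1] in the [g]; this
    supplies the powers of p in the screening operators. *)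
Lemma conjk_tcomr (g : int -> W) (c : K) r0 r j :
  (forall n, kk rho * g n * ki rho = c *: g n) ->
  kk rho * tcomr p (g r0) (g r) j * ki rho = c ^+ j.+1 *: tcomr p (g r0) (g r) j.
Proof.
move=> kg; elim: j => [|j IH]; first by rewrite kg expr1.
rewrite /= mulrBr mulrBl -scalerAr -scalerAl !conjk_mul IH kg.
rewrite -!(scalerAl, scalerAr) !scalerA scalerBr !scalerA [c ^+ j.+2]exprS.
by congr (_ *: _ - _ *: _); ring.
Qed.

Lemma iter_Sf j r : iter j (Sf rho) (ff rho r) = tcomr p (ff rho 0) (ff rho r) j.
Proof.
elim: j => //= j ->; rewrite /Sf (@conjk_tcomr _ _ 0 r j (k_f rho)).
by rewrite -scalerAr exprVn.
Qed.

(** Factoring -p^i out of the i-th step turns it into a right commutator; these factors multiply to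
    the stated coefficient. *)
Lemma iter_Se j r : iter j (Se rho) (ee rho r) =
  ((-1) ^+ j * q ^+ (j * j.+1)) *: tcomr p (ee rho 0) (ee rho r) j.
Proof.
elim: j => [|j IH]; first by rewrite mulr1 scale1r.
rewrite iterS IH /Se -!(scalerAl, scalerAr) (@conjk_tcomr _ _ 0 r j (k_e rho)) /=.
rewrite -!(scalerAl, scalerAr) -scalerBr -/p.
set t := tcomr _ _ _ _; have pj : p ^+ j.+1 != 0 by rewrite expf_neq0.
have -> : ee rho 0 * t - p ^+ j.+1 *: (t * ee rho 0) =
    - p ^+ j.+1 *: (t * ee rho 0 - p ^- j.+1 *: (ee rho 0 * t)).
  by rewrite scalerBr scaleNr scalerA mulNr divff // scaleN1r opprK addrC.
rewrite scalerA; congr (_ *: _).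
have -> : q ^+ (j.+1 * j.+2) = q ^+ (j * j.+1) * p ^+ j.+1.
  by rewrite /p -exprM -exprD; congr (_ ^+ _); lia.
by rewrite [(-1) ^+ j.+1]exprS; ring.
Qed.

Lemma iter_SfN j w : iter j (Sf rho) (- w) = - iter j (Sf rho) w.
Proof. by elim: j => //= j ->; rewrite /Sf !(mulrN, mulNr) opprB opprK addrC. Qed.

Lemma iter_SeN j w : iter j (Se rho) (- w) = - iter j (Se rho) w.
Proof. by elim: j => //= j ->; rewrite /Se !(mulrN, mulNr) opprB opprK addrC. Qed.

Lemma iter_Sf0 j : iter j (Sf rho) 0 = 0.
Proof. by elim: j => //= j ->; rewrite /Sf !(mulr0, mul0r) subrr. Qed.

Lemma iter_Se0 j : iter j (Se rho) 0 = 0.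
Proof. by elim: j => //= j ->; rewrite /Se !(mulr0, mul0r) subrr. Qed.
End Screening.

Variables rho1 rho2 : UqRep q W.
Hypothesis hcomm : commuting_pair rho1 rho2.

Lemma fe_comm r r' : ff rho1 r * ee rho2 r' = ee rho2 r' * ff rho1 r.
Proof.
apply: hcomm; rewrite /is_gen; last by do 5!right; left; exists r'.
by do 6!right; left; exists r.
Qed.

Lemma screening_comm j r j' r' :
  iter j (Sf rho1) (ff rho1 r) * iter j' (Se rho2) (ee rho2 r') =
  iter j' (Se rho2) (ee rho2 r') * iter j (Sf rho1) (ff rho1 r).
Proof.
rewrite iter_Sf iter_Se -scalerAr -scalerAl; congr (_ *: _).
by apply: tcomr_comm; apply/esym; apply: tcomr_comm; apply/esym; rewrite fe_comm.
Qed.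

Lemma log_coef_screening j r r' :
  log_coef j *: (tcomr p (ff rho1 0) (ff rho1 r) j * tcomr p (ee rho2 0) (ee rho2 r') j) =
  - (((-1) ^+ j.+1 * u / (qfact q j.+1 * qfact q j)) *:
    (iter j (Sf rho1) (ff rho1 r) * iter j (Se rho2) (ee rho2 r'))).
Proof.
rewrite iter_Sf iter_Se -scalerAr scalerA -scaleNr; congr (_ *: _).
rewrite /log_coef [(-1) ^+ j.+1]exprS.
have := sqrr_sign K j; rewrite expr2; set s := (-1) ^+ j => ss.
transitivity (s * s * (q ^+ (j * j.+1) * u / (qfact q j.+1 * qfact q j))); last by ring.
by rewrite ss mul1r.
Qed.

(** Dividing the relation for e by -p gives the form that the relation for f takes after reversal of
    modes. *)
Lemma ee_rel a b :
  ee rho2 a * ee rho2 (b + 1) - p^-1 *: (ee rho2 (a + 1) * ee rho2 b) =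
  p^-1 *: (ee rho2 (b + 1) * ee rho2 a) - ee rho2 b * ee rho2 (a + 1).
Proof.
apply: (scalerI p_neq0); rewrite !scalerBr !scalerA divff // !scale1r.
by rewrite -opprB e_e opprB.
Qed.

Lemma fplus_screening_comm j r j' r' :
  iter j (Sf rho1) (fplus rho1 (Posz r)) * iter j' (Se rho2) (eminus rho2 (- Posz r')) =
  iter j' (Se rho2) (eminus rho2 (- Posz r')) * iter j (Sf rho1) (fplus rho1 (Posz r)).
Proof.
rewrite /fplus; case: ifP => _; last by rewrite iter_Sf0 mulr0 mul0r.
rewrite /eminus; case: ifP => _; last by rewrite iter_Se0 mulr0 mul0r.
by rewrite iter_SeN mulrN mulNr screening_comm.
Qed.

Lemma fminus_screening_comm j r j' r' :
  iter j (Sf rho1) (fminus rho1 (- Posz r)) * iter j' (Se rho2) (eplus rho2 (Posz r')) =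
  iter j' (Se rho2) (eplus rho2 (Posz r')) * iter j (Sf rho1) (fminus rho1 (- Posz r)).
Proof.
rewrite /fminus; case: ifP => _; last by rewrite iter_Sf0 mulr0 mul0r.
by rewrite /eplus /= iter_SfN mulrN mulNr screening_comm.
Qed.

Let fp (r : nat) : W := ff rho1 (Posz r).
Let ep (r : nat) : W := ee rho2 (- Posz r).
Let fm (r : nat) : W^c := ff rho1 (- Posz r).
Let em (r : nat) : W^c := ee rho2 (Posz r).

Let PoszS r : Posz r.+1 = Posz r + 1. Proof. by rewrite -addn1. Qed.
Let NPoszS r : - Posz r = - Posz r.+1 + 1. Proof. by rewrite PoszS opprD subrK. Qed.

Let fp_rel m n : fp m.+1 * fp n - p^-1 *: (fp m * fp n.+1) =
  p^-1 *: (fp n * fp m.+1) - fp n.+1 * fp m.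
Proof. by rewrite /fp !PoszS f_f. Qed.

Let ep_rel m n : ep m.+1 * ep n - p^-1 *: (ep m * ep n.+1) =
  p^-1 *: (ep n * ep m.+1) - ep n.+1 * ep m.
Proof. by rewrite /ep (NPoszS n) (NPoszS m) ee_rel. Qed.

Let fm_rel m n : fm m.+1 * fm n - p^-1 *: (fm m * fm n.+1) =
  p^-1 *: (fm n * fm m.+1) - fm n.+1 * fm m.
Proof. by have := f_f rho1 (- Posz n.+1) (- Posz m.+1); rewrite -!NPoszS. Qed.

Let em_rel m n : em m.+1 * em n - p^-1 *: (em m * em n.+1) =
  p^-1 *: (em n * em m.+1) - em n.+1 * em m.
Proof. by have := ee_rel (Posz n) (Posz m); rewrite -!PoszS. Qed.

Lemma Rpm_comp_terms n M : Rpm_comp rho1 rho2 n M =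
  \sum_(m < n.+1) comp_term n M (log_term p log_coef fp ep 1) m n M.
Proof.
exact: (ordered_exp_formula p_neq0 p_expn1 exp_coef0 exp_coefS log_coef0 log_coefS
  (natr_neq0 1) fp_rel ep_rel (fun _ _ => fe_comm _ _) n natr_neq0 (add1n M)).
Qed.

Lemma Rmp_comp_terms n M : Rmp_comp rho1 rho2 n M =
  \sum_(m < n.+1) comp_term n M (log_term p log_coef fm em 0) m n M.
Proof.
apply: etrans (ordered_exp_formula p_neq0 p_expn1 exp_coef0 exp_coefS log_coef0
  log_coefS (natr_neq0 1) fm_rel em_rel (fun _ _ => esym (fe_comm _ _)) n natr_neq0
  (add0n M.+1)).
(* Read in the converse algebra, the increasing product becomes a decreasing one. *)
apply: eq_bigr => f _; rewrite rev_prodr revK; apply: eq_bigr => i _.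
congr (_ *: _); apply: etrans (esym (@revrX W _ _)).
exact: (congr1 (fun w : W => w ^+ f i) (fe_comm _ _)).
Qed.

Lemma Rpm_comp0 M : Rpm_comp rho1 rho2 0 M = (M == 0)%:R.
Proof. by rewrite Rpm_comp_terms big_ord_recl big_ord0 addr0 comp_term0. Qed.

Lemma Rmp_comp0 M : Rmp_comp rho1 rho2 0 M = (M == 0)%:R.
Proof. by rewrite Rmp_comp_terms big_ord_recl big_ord0 addr0 comp_term0. Qed.

Lemma Rpm_formula n M : (0 < n)%N -> Rpm_comp rho1 rho2 n M = Rpm_rhs rho1 rho2 n M.
Proof.
move=> n_gt0; rewrite Rpm_comp_terms big_ord_recl comp_term0 (gtn_eqF n_gt0) add0r.
rewrite /Rpm_rhs big_add1 big_mkord; apply: eq_bigr => m _.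
apply: (@sum_mode_sum _ n M _
  (fun j r => iter j (Sf rho1) (fplus rho1 (Posz r)))
  (fun j r => iter j (Se rho2) (eminus rho2 (- Posz r))) _ _ _ _ (@prod_partial_sums K n m.+1)).
- by [].
- move=> j r.
  (* The product starts at mode 1, but rewriting through mode 0 brings in [f_0] and [e_0]; the
     strict bound excludes r = 0, as in f_+. *)
  rewrite (log_term_tcomr _ p_neq0 (natr_neq0 1) fp_rel ep_rel) !muln0 subn0 /fplus /eminus.
  case: r => [|r] /=; first by rewrite iter_Sf0 mul0r scaler0.
  by rewrite log_coef_screening iter_SeN mulrN scalerN.
exact: fplus_screening_comm.
Qed.

Lemma Rmp_formula n M : (0 < n)%N -> Rmp_comp rho1 rho2 n M = Rmp_rhs rho1 rho2 n M.
Proof.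
move=> n_gt0; rewrite Rmp_comp_terms big_ord_recl comp_term0 (gtn_eqF n_gt0) add0r.
rewrite /Rmp_rhs big_add1 big_mkord; apply: eq_bigr => m _.
refine (etrans (@comp_term_converse K W n M (log_term p log_coef fm em 0) m.+1 n M) _).
apply: (@sum_mode_sum _ n M _
  (fun j r => iter j (Sf rho1) (fminus rho1 (- Posz r)))
  (fun j r => iter j (Se rho2) (eplus rho2 (Posz r))) _ _ _ _
  (fun j => \prod_(i < m.+1) ((\sum_(l < m.+1 | (i <= l)%N) j l)%N)%:R)).
- by [].
(* Here the product starts at mode 0, so [f_0] and [e_0] occur at once, and left commutators of the
   converse algebra are right ones in [W]. *)
- move=> j r; rewrite /log_term !muln0 /= !tcoml_converse subn0 /fminus /eplus /=.
  have -> : - Posz r <= 0 by case: r.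
  have ef : GRing.comm (tcomr p (ee rho2 0) (ee rho2 r) j)
                       (tcomr p (ff rho1 0) (ff rho1 (- Posz r)) j).
    by apply: tcomr_comm; apply: commr_sym; apply: tcomr_comm; apply: fe_comm.
  by rewrite iter_SfN mulNr scalerN -log_coef_screening -ef.
exact: fminus_screening_comm.
Qed.
End RMatrix.

Theorem theorem2 (R : realType) (q : R[i])
  (hq0 : q != 0) (hq : forall N : int, N != 0 -> q ^ N != 1)
  (W : algType R[i]) (rho1 rho2 : UqRep q W)
  (hcomm : commuting_pair rho1 rho2) :
  (forall M : nat,
     Rpm_comp rho1 rho2 0 M = (M == 0)%:R /\ Rmp_comp rho1 rho2 0 M = (M == 0)%:R) /\
  (forall n M : nat, (0 < n)%N ->
     Rpm_comp rho1 rho2 n M = Rpm_rhs rho1 rho2 n M /\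
     Rmp_comp rho1 rho2 n M = Rmp_rhs rho1 rho2 n M).
Proof.
have q_expn1 n : (0 < n)%N -> q ^+ n != 1.
  by case: n => // n _; rewrite exprnP hq.
have natr_neq0 n : (n.+1%:R : R[i]) != 0 by rewrite pnatr_eq0.
split=> [M|n M n_gt0]; split.
- exact: Rpm_comp0.
- exact: Rmp_comp0.
- exact: Rpm_formula.
- exact: Rmp_formula.
Qed.
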